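(* Let $n\ge 2$ and let $(X,T)$ be a minimal distal system of class $n$, with $X=G_0\times G_1\times\cdots\times G_n$. For $1\le j\le n$ let $e_j$ be the unit of $G_j$. The following statements are equivalent: (1) the $n$-tuple $$(G_0\times\cdots\times G_{n-1}\times\{e_n\},\ G_0\times\cdots\times G_{n-2}\times\{e_{n-1}\}\times\{e_n\},\ \dots,\ G_0\times\{e_1\}\times\cdots\times\{e_n\})\in K(X)^n,$$ whose $k$-th entry ($1\le k\le n$) is $G_0\times\cdots\times G_{n-k}\times\{e_{n-k+1}\}\times\cdots\times\{e_n\}$, is recurrent under $T_K^{(n)}$; (2) there exist $g_j^i\in G_j$ ($1\le j\le n$, $1\le i\le j$) such that the $n$-tuple $$(G_0\times\cdots\times G_{n-1}\times\{g_n^1\},\ \dots,\ G_0\times\{g_1^1\}\times\cdots\times\{g_n^n\})\in K(X)^n,$$ whose $k$-th entry ($1\le k\le n$) is $G_0\times\cdots\times G_{n-k}\times\{g_{n-k+1}^1\}\times\{g_{n-k+2}^2\}\times\cdots\times\{g_n^k\}$, is recurrent under $T_K^{(n)}$; (3) $(K(X),T_K)$ is $n$-rigid; (4) $(X,T)$ is uniformly rigid.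
   Context: $(X,T)$ is called a minimal distal system of class $n$ if it is realized as $n+1$ consecutive skew products, i.e. there are a compact metric Abelian group $G_0$ with a minimal rotation $S_0:G_0\to G_0$, compact metric groups $G_1,\dots,G_n$, continuous maps $\phi_i:G_0\times\cdots\times G_{i-1}\to G_i$ ($i=1,\dots,n$), and skew products $$S_i(g_0,\dots,g_i)=(S_{i-1}(g_0,\dots,g_{i-1}),\ \phi_i(g_0,\dots,g_{i-1})\,g_i)$$ acting on $G_0\times\cdots\times G_i$ for $i=1,\dots,n$, such that $X=G_0\times\cdots\times G_n$ and $T=S_n$. (Then $T$ is a homeomorphism of the compact metrizable space $X$.) $K(X)$ is the set of non-empty closed subsets of $X$ with the Hausdorff metric, $T_K(A)=T(A)$, and $T_K^{(n)}=T_K\times\cdots\times T_K$ ($n$ times) acting on $K(X)^n$. For a homeomorphism $R$ of a compact metric space $Z$, a point $z\in Z$ is recurrent if there is a sequence of integers $n_i\to+\infty$ or a sequence $n_i\to-\infty$ with $R^{n_i}z\to z$; $(Z,R)$ is $n$-rigid if every point of $Z^n$ is recurrent under $R^{(n)}$; $(Z,R)$ is uniformly rigid if there is a sequence of positive integers $m_i\to\infty$ with $R^{m_i}\to\mathrm{id}$ uniformly on $Z$. *)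

(* Defs.v *)
From HB Require Import structures.
From mathcomp Require Import all_boot all_order all_algebra.
From mathcomp Require Import all_classical all_reals all_analysis.

Set Implicit Arguments.
Unset Strict Implicit.
Unset Printing Implicit Defensive.

Import Order.TTheory GRing.Theory Num.Theory.

Local Open Scope classical_set_scope.
Local Open Scope ring_scope.

HB.mixin Record Metric_isCompact (R : realType) M & Metric R M := {
  space_compact : compact [set: M]
}.

#[short(type="compactMetricType")]
HB.structure Definition CompactMetric (R : realType) :=
  { M of Metric R M & Metric_isCompact R M }.

HB.mixin Record isCompatibleGroup (R : realType) G
    & CompactMetric R G & Group G := {
  mulg_continuous : continuous (fun p : G * G => (p.1 * p.2)%g) ;
  invg_continuous : continuous (fun g : G => (g^-1)%g)
}.

#[short(type="compactMetricGroupType")]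
HB.structure Definition CompactMetricGroup (R : realType) :=
  { G of CompactMetric R G & Group G & isCompatibleGroup R G }.

(* Products carry the maximum metric, whose balls are the product balls already
   attached to M * N by the library. *)
Section product_metric.
Context {R : realType} {M N : metricType R}.

Definition max_dist (x y : M * N) : R :=
  Num.max (mdist x.1 y.1) (mdist x.2 y.2).

Lemma max_dist_ge0 x y : 0 <= max_dist x y.
Proof. by rewrite /max_dist le_max mdist_ge0. Qed.

Lemma max_dist_positivity x y : max_dist x y = 0 -> x = y.
Proof.
case: x y => [x1 x2] [y1 y2] /= d0; have : max_dist (x1, x2) (y1, y2) <= 0.
  by rewrite d0.
rewrite ge_max /= => /andP[d1 d2].
by congr pair; apply: (@mdist_positivity R); apply/eqP;
  rewrite eq_le ?d1 ?d2 mdist_ge0.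
Qed.

Lemma ball_max_dist x d : ball x d = [set y | max_dist x y < d].
Proof.
apply/seteqP; split=> y /=; rewrite /max_dist gt_max /ball /= /prod_ball
  !ballEmdist /=.
- by case=> -> ->.
- by move/andP.
Qed.

HB.instance Definition _ := PseudoMetric_isMetric.Build R (M * N)%type
  max_dist_ge0 max_dist_positivity ball_max_dist.
End product_metric.

Lemma product_space_compact (R : realType) (M N : compactMetricType R) :
  compact [set: M * N].
Proof. by rewrite -setXTT; apply: compact_setX; exact: space_compact. Qed.

HB.instance Definition _ (R : realType) (M N : compactMetricType R) :=
  Metric_isCompact.Build R (M * N)%type (@product_space_compact R M N).

Section compact_metric_facts.
Context {R : realType}.

Lemma metric_closed1 (M : metricType R) (x : M) : closed [set x].
Proof.
by apply: accessible_closed_set1; apply: hausdorff_accessible;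
  exact: metric_hausdorff.
Qed.

Lemma dist_bounded (M : compactMetricType R) :
  exists2 e : R, 0 < e & forall x y : M, mdist x y < e.
Proof.
have [[x0]|M0] := pselect (inhabited M); last first.
  by exists 1 => // x; case: M0; split.
have : \forall e \near +oo, forall x : M, mdist x0 x < e.
  have := (compact_near_coveringP [set: M]).1 (@space_compact R M).
  move=> /(_ R (+oo : set_system R) (fun e x => mdist x0 x < e)) /= h.
  have {h} : \forall e \near +oo, [set: M] `<=` (fun x => mdist x0 x < e).
    apply: h => x _.
    exists (ball x 1, [set e : R | mdist x0 x + 1 < e]).
      split; first exact: nbhsx_ballx.
      by apply: nbhs_pinfty_gt; rewrite num_real.
    case=> y e /= [xy lee]; rewrite ballEmdist /= in xy.
    apply: le_lt_trans (metric_triangle _ x _) _.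
    by apply: lt_trans lee; rewrite ltrD2l.
  by apply: filterS => e he x; exact: he.
move=> [e [_ he]].
have hr (r : R) : e < r -> forall x : M, mdist x0 x < r by exact: he.
pose d := Num.max (e + 1) 1.
have d0 : 0 < d by rewrite lt_max ltr01 orbT.
have hd : forall x : M, mdist x0 x < d.
  by apply: hr; rewrite lt_max ltrDl ltr01.
exists (d + d); first by rewrite addr_gt0.
move=> x y; apply: le_lt_trans (metric_triangle _ x0 _) _.
by rewrite ltrD // metric_sym.
Qed.

Lemma compact_unif_continuous (M : compactMetricType R) (N : metricType R)
    (f : M -> N) : continuous f ->
  forall e : R, 0 < e -> exists2 d : R, 0 < d &
    forall x y, mdist x y < d -> mdist (f x) (f y) < e.
Proof.
move=> cf e e0.
have e20 : 0 < e / 2 by rewrite divr_gt0.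
have := (compact_near_coveringP [set: M]).1 (@space_compact R M).
move=> /(_ R (0^'+ : set_system R)
  (fun d x => forall y, mdist x y < d -> mdist (f x) (f y) < e)) /= h.
have {h} : \forall d \near 0^'+, [set: M] `<=`
    (fun x => forall y, mdist x y < d -> mdist (f x) (f y) < e).
  apply: h => x _.
  have : nbhs x (f @^-1` ball (f x) (e / 2)).
    by apply: cf; exact: nbhsx_ballx.
  move=> /nbhs_ballP[r /= r0 hr].
  have r20 : 0 < r / 2 by rewrite divr_gt0.
  have near_f z : mdist x z < r -> mdist (f x) (f z) < e / 2.
    move=> xz; have := hr z; rewrite ballEmdist /= => /(_ xz).
    by rewrite ballEmdist.
  exists (ball x (r / 2), [set d : R | d < r / 2]).
    split; first exact: nbhsx_ballx.
    exact: nbhs_right_lt.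
  case=> x' d /= [xx' dr] y x'y; rewrite ballEmdist /= in xx'.
  have xy : mdist x y < r.
    apply: le_lt_trans (metric_triangle _ x' _) _.
    by rewrite (splitr r) ltrD // (lt_trans x'y).
  apply: le_lt_trans (metric_triangle _ (f x) _) _.
  rewrite (splitr e) ltrD //; last exact: near_f.
  rewrite metric_sym; apply: near_f; apply: lt_trans xx' _.
  by rewrite ltr_pdivrMr // ltr_pMr // ltr1n.
move=> h; near (0:R)^'+ => d.
exists d; first by near: d; exact: nbhs_right_gt.
move=> x y; have : [set: M] `<=`
    (fun x => forall y, mdist x y < d -> mdist (f x) (f y) < e) by near: d.
by apply.
Unshelve. all: by end_near. Qed.

End compact_metric_facts.

Record hyperspace (R : realType) (X : compactMetricType R) := Hyperspace {
  hyper_set :> set X ;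
  hyper_closed : closed hyper_set ;
  hyper_nonempty : hyper_set !=set0
}.

Arguments hyper_closed {R X} h.
Arguments hyper_nonempty {R X} h.

Lemma hyperspace_inj (R : realType) (X : compactMetricType R) :
  injective (@hyper_set R X).
Proof.
move=> [A cA A0] [B cB B0] /= AB; subst B.
by congr Hyperspace; exact: Prop_irrelevance.
Qed.

HB.instance Definition _ (R : realType) (X : compactMetricType R) :=
  gen_eqMixin (hyperspace X).
HB.instance Definition _ (R : realType) (X : compactMetricType R) :=
  gen_choiceMixin (hyperspace X).

Section hausdorff_metric.
Context {R : realType} {X : compactMetricType R}.
Implicit Types A B C : hyperspace X.

Definition thickening (A : set X) (e : R) : set X :=
  [set x | exists2 a, A a & mdist a x < e].

Definition hausdorff_radii A B : set R :=
  [set e | [/\ 0 < e, A `<=` thickening B e & B `<=` thickening A e]].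

Definition hausdorff_dist A B : R := inf (hausdorff_radii A B).

Lemma hausdorff_radii_has_inf A B : has_inf (hausdorff_radii A B).
Proof.
split; last by exists 0 => e [/ltW].
have [e e0 he] := dist_bounded X.
have [[a Aa] [b Bb]] := (hyper_nonempty A, hyper_nonempty B).
by exists e; split=> // x _; [exists b|exists a].
Qed.

Lemma hausdorff_dist_lb A B e : hausdorff_radii A B e -> hausdorff_dist A B <= e.
Proof. by apply: ge_inf; have [] := hausdorff_radii_has_inf A B. Qed.

Lemma hausdorff_dist_ge0 A B : 0 <= hausdorff_dist A B.
Proof.
apply: lb_le_inf; first by have [] := hausdorff_radii_has_inf A B.
by move=> e [/ltW].
Qed.

Lemma hausdorff_dist_lt A B e : hausdorff_dist A B < e -> hausdorff_radii A B e.
Proof.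
move=> /(inf_lt (hausdorff_radii_has_inf A B).1)[r [r0 AB BA] re].
split; first exact: lt_trans re.
- by move=> x /AB[y By yx]; exists y => //; exact: lt_trans re.
- by move=> x /BA[y By yx]; exists y => //; exact: lt_trans re.
Qed.

Lemma hausdorff_distxx A : hausdorff_dist A A = 0.
Proof.
apply/eqP; rewrite eq_le hausdorff_dist_ge0 andbT.
apply/ler_addgt0Pl => e e0; rewrite addr0; apply: hausdorff_dist_lb.
by split=> // x Ax; exists x => //; rewrite mdistxx.
Qed.

Lemma hausdorff_dist_sym A B : hausdorff_dist A B = hausdorff_dist B A.
Proof.
by rewrite /hausdorff_dist; congr inf; apply/seteqP; split=> e [].
Qed.

Lemma hausdorff_dist_triangle B A C :
  hausdorff_dist A C <= hausdorff_dist A B + hausdorff_dist B C.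
Proof.
apply/ler_addgt0Pl => e e0; rewrite (splitr e) addrACA.
have e20 : 0 < e / 2 by rewrite divr_gt0.
have /hausdorff_dist_lt [r0 AB BA] :
  hausdorff_dist A B < e / 2 + hausdorff_dist A B by rewrite ltrDr.
have /hausdorff_dist_lt [s0 BC CB] :
  hausdorff_dist B C < e / 2 + hausdorff_dist B C by rewrite ltrDr.
apply: hausdorff_dist_lb; split; first exact: addr_gt0.
- move=> x /AB[y /BC[z Cz zy] yx]; exists z => //.
  by apply: le_lt_trans (metric_triangle _ y _) _; rewrite addrC ltrD.
- move=> x /CB[y /BA[z Cz zy] yx]; exists z => //.
  by apply: le_lt_trans (metric_triangle _ y _) _; rewrite ltrD.
Qed.

Lemma hausdorff_dist_subset A B : hausdorff_dist A B = 0 -> A `<=` B.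
Proof.
move=> AB0 x Ax; apply: (hyper_closed B) => U /nbhs_ballP[e /= e0 xeU].
have /hausdorff_dist_lt[_ AB _] : hausdorff_dist A B < e by rewrite AB0.
have [y By yx] := AB _ Ax; exists y; split=> //; apply: xeU.
by rewrite ballEmdist /= metric_sym.
Qed.

Lemma hausdorff_dist_positivity A B : hausdorff_dist A B = 0 -> A = B.
Proof.
move=> AB0; apply: hyperspace_inj; apply/seteqP; split.
  exact: hausdorff_dist_subset.
by apply: hausdorff_dist_subset; rewrite hausdorff_dist_sym.
Qed.

HB.instance Definition _ := isMetric.Build R (hyperspace X)
  hausdorff_distxx hausdorff_dist_positivity hausdorff_dist_sym
  hausdorff_dist_triangle.

End hausdorff_metric.

Record homeomorphism (Z : topologicalType) := Homeomorphism {
  hom_fun :> Z -> Z ;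
  hom_inv : Z -> Z ;
  hom_funK : cancel hom_fun hom_inv ;
  hom_invK : cancel hom_inv hom_fun ;
  hom_continuous : continuous hom_fun ;
  hom_inv_continuous : continuous hom_inv
}.

Arguments hom_funK {Z} h.
Arguments hom_invK {Z} h.
Arguments hom_continuous {Z} h.
Arguments hom_inv_continuous {Z} h.

Definition int_iter (Z : topologicalType) (T : homeomorphism Z) (m : int)
    : Z -> Z :=
  match m with
  | Posz k => iter k T
  | Negz k => iter k.+1 (hom_inv T)
  end.

Definition tends_to_pinfty (u : nat -> int) :=
  forall M : int, \forall i \near \oo, M <= u i.

Definition tends_to_ninfty (u : nat -> int) :=
  forall M : int, \forall i \near \oo, u i <= M.

Definition recurrent (Z : topologicalType) (T : homeomorphism Z) (z : Z) :=
  exists u : nat -> int, (tends_to_pinfty u \/ tends_to_ninfty u) /\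
    int_iter T (u i) z @[i --> \oo] --> z.

Definition minimal (Z : topologicalType) (T : homeomorphism Z) :=
  forall z : Z, dense (range (fun m : int => int_iter T m z)).

Definition uniformly_rigid (R : realType) (Z : compactMetricType R)
    (T : homeomorphism Z) :=
  exists m : nat -> nat, [/\ (forall i, (0 < m i)%N), m i @[i --> \oo] --> \oo &
    {uniform, (fun i => iter (m i) T) @ \oo --> (id : Z -> Z)}].

Section power.
Context {Z : topologicalType} (n : nat) (T : homeomorphism Z).

Definition power_fun (f : Z -> Z) (z : {ptws 'I_n -> Z}) : {ptws 'I_n -> Z} :=
  fun k => f (z k).

Lemma power_fun_continuous f : continuous f -> continuous (power_fun f).
Proof.
move=> cf z; apply/cvg_sup.
  exact/fmap_filter/(nbhs_filter (z : {ptws 'I_n -> Z})).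
move=> k.
apply: (@continuous_comp_initial _ _ _ (fun z : 'I_n -> Z => z k)
  (power_fun f : {ptws 'I_n -> Z} -> _)) => {}z.
apply: (@continuous_comp _ _ _ (fun z : {ptws 'I_n -> Z} => z k) f z).
  exact: (@proj_continuous _ (fun=> Z)).
exact: cf.
Qed.

Lemma power_funK f g : cancel f g -> cancel (power_fun f) (power_fun g).
Proof. by move=> fK z; apply/funext => k; rewrite /power_fun fK. Qed.

Definition power : homeomorphism {ptws 'I_n -> Z} :=
  Homeomorphism (power_funK (hom_funK T)) (power_funK (hom_invK T))
    (power_fun_continuous (hom_continuous T))
    (power_fun_continuous (hom_inv_continuous T)).
End power.

Definition rigid (n : nat) (Z : topologicalType) (T : homeomorphism Z) :=
  forall z : {ptws 'I_n -> Z}, recurrent (power n T) z.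

Section hyper_map.
Context {R : realType} {X : compactMetricType R} (T : homeomorphism X).

Section image.
Variables (f : X -> X) (cf : continuous f).

Lemma image_closed (A : hyperspace X) : closed (f @` A).
Proof.
apply: compact_closed; first exact: metric_hausdorff.
apply: continuous_compact; first exact: continuous_subspaceT.
by apply: subclosed_compact (@space_compact R X) _ => //; exact: hyper_closed.
Qed.

Lemma image_nonempty (A : hyperspace X) : f @` A !=set0.
Proof. by have [a Aa] := hyper_nonempty A; exists (f a), a. Qed.

Arguments image_closed : clear implicits.
Arguments image_nonempty : clear implicits.

Definition hyper_image (A : hyperspace X) : hyperspace X :=
  Hyperspace (image_closed A) (image_nonempty A).

Lemma hyper_image_continuous : continuous hyper_image.
Proof.
move=> A; apply/(metricType_numDomainType.cvgrPdist_le (FF := nbhs_filter A)).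
move=> e e0.
have [d d0 hd] := compact_unif_continuous cf e0.
have : nbhs A (ball A d) by exact: nbhsx_ballx.
apply: filterS => B; rewrite ballEmdist /= => /hausdorff_dist_lt[_ AB BA].
apply: hausdorff_dist_lb; split=> // _ [x Hx <-].
- by have [y By yx] := AB _ Hx; exists (f y); [exists y|exact: hd].
- by have [y By yx] := BA _ Hx; exists (f y); [exists y|exact: hd].
Qed.
End image.
Arguments hyper_image_continuous : clear implicits.

Lemma hyper_imageK (f g : X -> X) (cf : continuous f) (cg : continuous g) :
  cancel f g -> cancel (hyper_image cf) (hyper_image cg).
Proof.
move=> fK A; apply: hyperspace_inj; rewrite /= image_comp.
by rewrite (_ : g \o f = id) ?image_id //; apply/funext => x /=; rewrite fK.
Qed.

Definition hyper_map : homeomorphism (hyperspace X) :=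
  Homeomorphism
    (hyper_imageK (hom_continuous T) (hom_inv_continuous T) (hom_funK T))
    (hyper_imageK (hom_inv_continuous T) (hom_continuous T) (hom_invK T))
    (hyper_image_continuous T (hom_continuous T))
    (hyper_image_continuous (hom_inv T) (hom_inv_continuous T)).
End hyper_map.

Section rotation_and_skew_product.
Context {R : realType}.

Lemma mulg_continuous2 (Y : topologicalType) (G : compactMetricGroupType R)
    (f g : Y -> G) :
  continuous f -> continuous g -> continuous (fun y => (f y * g y)%g).
Proof.
move=> cf cg y; apply: (@continuous_comp _ _ _ (fun y => (f y, g y))
  (fun p : G * G => (p.1 * p.2)%g)); last exact: mulg_continuous.
by apply: cvg_pair; [exact: cf|exact: cg].
Qed.

Section rotation.
Variables (G : compactMetricGroupType R) (a : G).

Lemma rotation_continuous (b : G) : continuous (fun g : G => (b * g)%g).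
Proof.
by apply: mulg_continuous2 => x; [exact: cvg_cst|exact: cvg_id].
Qed.

Lemma rotationK : cancel (fun g : G => (a * g)%g) (fun g => (a^-1 * g)%g).
Proof. exact: mulKg. Qed.

Lemma rotationVK : cancel (fun g : G => (a^-1 * g)%g) (fun g => (a * g)%g).
Proof. exact: mulVKg. Qed.

Definition rotation : homeomorphism G :=
  Homeomorphism rotationK rotationVK
    (@rotation_continuous a) (@rotation_continuous (a^-1)%g).
End rotation.

Section skew_product.
Variables (Y : compactMetricType R) (G : compactMetricGroupType R).
Variables (S : homeomorphism Y) (phi : Y -> G) (cphi : continuous phi).

Definition skew_fun (p : Y * G) : Y * G := (S p.1, (phi p.1 * p.2)%g).

Definition skew_inv (p : Y * G) : Y * G :=
  (hom_inv S p.1, ((phi (hom_inv S p.1))^-1 * p.2)%g).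

Lemma skew_funK : cancel skew_fun skew_inv.
Proof. by case=> y g; rewrite /skew_inv /= hom_funK mulKg. Qed.

Lemma skew_invK : cancel skew_inv skew_fun.
Proof. by case=> y g; rewrite /skew_fun /= hom_invK mulVKg. Qed.

Lemma continuous_fst_comp (W : topologicalType) (f : Y -> W) :
  continuous f -> continuous (fun p : Y * G => f p.1).
Proof.
by move=> cf p; apply: (@continuous_comp _ _ _ fst f p);
  [exact: cvg_fst|exact: cf].
Qed.

Lemma skew_fun_continuous : continuous skew_fun.
Proof.
move=> p; apply: cvg_pair.
  exact: (continuous_fst_comp (hom_continuous S)).
apply: (@mulg_continuous2 _ _ (fun p : Y * G => phi p.1) snd).
  exact: continuous_fst_comp.
by move=> q; exact: cvg_snd.
Qed.

Lemma skew_inv_continuous : continuous skew_inv.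
Proof.
have cS := hom_inv_continuous S.
move=> p; apply: cvg_pair; first exact: (continuous_fst_comp cS).
apply: (@mulg_continuous2 _ _
  (fun p : Y * G => (phi (hom_inv S p.1))^-1%g) snd); last first.
  by move=> q; exact: cvg_snd.
apply: (@continuous_fst_comp _ (fun y => ((phi (hom_inv S y))^-1)%g)) => y.
apply: (@continuous_comp _ _ _ (phi \o hom_inv S) (fun g => (g^-1)%g)).
  by apply: continuous_comp; [exact: cS|exact: cphi].
exact: invg_continuous.
Qed.

Definition skew_product : homeomorphism (Y * G)%type :=
  Homeomorphism skew_funK skew_invK skew_fun_continuous skew_inv_continuous.
End skew_product.
End rotation_and_skew_product.

Section tower.
Context {R : realType} (G : nat -> compactMetricGroupType R).

(* A system of class n only involves G j for j <= n and phi i for i < n; the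
   remaining terms of the two sequences are unused. *)
Fixpoint tower (n : nat) : compactMetricType R :=
  match n with
  | 0 => G 0%N
  | m.+1 => (tower m * G m.+1)%type
  end.

Fixpoint tower_map (a : G 0%N) (phi : forall i, tower i -> G i.+1)
    (cphi : forall i, continuous (phi i)) (n : nat) : homeomorphism (tower n) :=
  match n with
  | 0 => rotation a
  | m.+1 => skew_product (tower_map a cphi m) (cphi m)
  end.

(* slab_set m g n is G 0 * ... * G m * {g (m+1)} * ... * {g n} for m <= n. *)
Fixpoint slab_set (m : nat) (g : forall j, G j) (n : nat) : set (tower n) :=
  match n with
  | 0 => setT
  | p.+1 => @slab_set m g p `*` (if (p < m)%N then setT else [set g p.+1])
  end.

Arguments slab_set : clear implicits.

Lemma slab_set_closed m g n : closed (slab_set m g n).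
Proof.
elim: n => [|n IHn] /=; first exact: closedT.
set B := (if _ then _ else _).
have cB : closed B.
  by rewrite /B; case: ifP => _; [exact: closedT|exact: metric_closed1].
have -> : slab_set m g n `*` B =
  (fst @^-1` slab_set m g n) `&` (snd @^-1` B) by [].
apply: closedI; apply: preimage_closed => //.
- by move=> ? ?; exact: cvg_fst.
- by move=> ? ?; exact: cvg_snd.
Qed.

Lemma slab_set_nonempty m g n : slab_set m g n !=set0.
Proof.
elim: n => [|n [x xP]] /=; first by exists 1%g.
by exists (x, g n.+1); split=> //=; case: ifP.
Qed.

Arguments slab_set_closed : clear implicits.
Arguments slab_set_nonempty : clear implicits.

Definition slab m g n : hyperspace (tower n) :=
  Hyperspace (slab_set_closed m g n) (slab_set_nonempty m g n).

(* With k = i + 1 for i : 'I_n, the k-th entry is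
   G 0 * ... * G (n-k) * {g (n-k+1) 1} * {g (n-k+2) 2} * ... * {g n k};
   g j i is only used for 1 <= i <= j <= n. *)
Definition slab_tuple (g : forall j : nat, nat -> G j) (n : nat)
    : {ptws 'I_n -> hyperspace (tower n)} :=
  fun i => slab (n - i.+1) (fun j => g j (j - (n - i.+1))%N) n.

End tower.
Arguments slab {R G} m g n.
Arguments slab_tuple {R G} g n.

(* Main.v *)
(* Let T^m (y, h) = (S^m y, c_m(y) h) on the (q+1)-st level of the tower.  If the
   tuple of slabs in (2) is recurrent along u_i, then its entry
   G_0 x ... x G_q x {g_(q+1)} x ... forces c_(u_i) to tend to 1 uniformly on
   G_0 x ... x G_q, for each q < n.  The base rotation is not controlled by these
   entries, but by compactness of G_0 the powers a^(u_i) accumulate somewhere; so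
   there are i, j with T^(u_i) and T^(u_j) uniformly close and u_j - u_i of large
   absolute value, whence T^|u_j - u_i| is uniformly close to the identity. *)
Require Import Defs.
From mathcomp Require Import all_boot all_order all_algebra.
From mathcomp Require Import all_classical all_reals all_analysis.
From mathcomp Require Import zify.

Set Implicit Arguments.
Unset Strict Implicit.
Unset Printing Implicit Defensive.

Import Order.TTheory GRing.Theory Num.Theory.

Local Open Scope classical_set_scope.
Local Open Scope ring_scope.

(** * Coordinatewise convergence and integer iterates *)

Lemma ptws_cvgP (I : eqType) (V : topologicalType)
    (F : set_system {ptws I -> V}) (f : {ptws I -> V}) :
  Filter F -> F --> f <-> forall i : I, g i @[g --> F] --> f i.
Proof.
move=> FF; split=> [Ff i|Ff].
  by move=> W Wf; apply: (Ff (@^~ i @^-1` W));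
    exact: (@proj_continuous I (fun=> V) i f W Wf).
(* The pointwise topology is the supremum of those induced by the evaluations; each evaluation is
   onto because of the constant functions. *)
apply/cvg_sup => i; rewrite cvg_image; last first.
  by rewrite eqEsubset; split=> v // _; exists (cst v).
move=> W /Ff Wf; exists (@^~ i @^-1` W) => //.
by rewrite eqEsubset; split => [j [? + <-//]|j Wj]; exists (fun _ => j).
Qed.

Section int_iter.
Context {Z : topologicalType} (T : homeomorphism Z).

Lemma int_iterS (m : int) z : int_iter T (m + 1) z = T (int_iter T m z).
Proof.
case: m => [m|[|m]].
- by rewrite -PoszD addn1.
- by rewrite /= hom_invK.
- have -> : Negz m.+1 + 1 = Negz m by lia.
  by rewrite /= hom_invK.
Qed.

Lemma int_iterD (m : int) (k : nat) z :
  int_iter T (m + k%:Z) z = iter k T (int_iter T m z).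
Proof.
elim: k => [|k IHk]; first by rewrite addr0.
by rewrite -[k.+1]addn1 PoszD addrA int_iterS IHk addn1.
Qed.

Lemma int_iter_surj (m : int) z : exists x, int_iter T m x = z.
Proof.
have iterK f g k : cancel f g -> cancel (iter k f) (iter k g).
  by move=> fK; elim: k => // k IHk y; rewrite iterSr iterS fK.
case: m => k; [exists (iter k (hom_inv T) z)|exists (iter k.+1 T z)];
  apply: iterK; [exact: hom_invK|exact: hom_funK].
Qed.

Lemma int_iter_power n m (z : {ptws 'I_n -> Z}) i :
  int_iter (power n T) m z i = int_iter T m (z i).
Proof.
case: m => k; rewrite /int_iter.
  by elim: k => //= k IHk; rewrite /power_fun IHk.
by elim: k.+1 => //= j IHj; rewrite /power_fun IHj.
Qed.

End int_iter.

(** * Uniform rigidity and the induced map on the hyperspace *)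

Section hyper_iter.
Context {R : realType} {X : compactMetricType R} (T : homeomorphism X).

Lemma int_iter_hyper_map (m : int) (A : hyperspace X) :
  hyper_set (int_iter (hyper_map T) m A) = int_iter T m @` A.
Proof.
case: m => k; rewrite /int_iter.
  by elim: k => [|k IHk] /=; rewrite ?image_id // IHk image_comp.
by elim: k.+1 => [|j IHj] /=; rewrite ?image_id // IHj image_comp.
Qed.

(** For the converse, tolerance [1/(i+1)] and lower bound [i] select times that tend to infinity and
    along which the iterates tend uniformly to the identity. *)
Lemma uniformly_rigidP : uniformly_rigid T <->
  forall (e : R) (N : nat), 0 < e ->
    exists2 k, (N < k)%N & forall x, mdist (iter k T x) x < e.
Proof.
split=> [[m [m_gt0 m_oo m_id]] e N e0|H].
  have near_id : \forall i \near \oo, forall x, mdist (iter (m i) T x) x < e.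
    apply: (m_id [set f | forall x, mdist (f x) x < e]); apply/uniform_nbhs.
    exists [set p : X * X | ball p.1 e p.2]; split.
      exact: (entourage_ball X (PosNum e0)).
    move=> h /= hh x; have := hh x I.
    by rewrite ballEmdist /= metric_sym.
  have m_gtN : \forall i \near \oo, (N < m i)%N.
    exact: (cvgnyPgt _).1.
  near \oo => i; exists (m i); first by near: i.
  by near: i.
have {H} /choice [m mP] (i : nat) : exists k, (i < k)%N /\
    forall x, mdist (iter k T x) x < i.+1%:R^-1 :> R.
  by have [|k] := H (i.+1%:R^-1) i; [rewrite invr_gt0|exists k].
exists m; split.
- by move=> i; have [] := mP i; case: (m i).
- apply/cvgnyPge => N; exists N => // i /= Ni.
  by have [im _] := mP i; exact: leq_trans Ni (ltnW im).
- move=> P /uniform_nbhs [E [entE EP]].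
  have [e /= e0 eE] : exists2 e : R, 0 < e &
      [set p : X * X | ball p.1 e p.2] `<=` E.
    by move: entE; rewrite -entourage_from_ballE.
  have : \forall i \near \oo, i.+1%:R^-1 < e.
    exact: near_infty_natSinv_lt (PosNum e0).
  apply: filterS => i ie; apply: EP => x _; apply: eE => /=.
  rewrite ballEmdist /= metric_sym.
  by have [_ /(_ x)] := mP i; move=> /lt_trans; apply.
Unshelve. all: by end_near. Qed.

(** A map displacing every point by less than [e] moves every closed set by at most [e] in the
    Hausdorff metric, so one sequence of times serves all entries of all tuples. *)
Lemma uniformly_rigid_hyper_map n :
  uniformly_rigid T -> rigid n (hyper_map T).
Proof.
move=> /uniformly_rigidP H z.
have /choice [m mP] (i : nat) : exists k, (i < k)%N /\
    forall x, mdist (iter k T x) x < i.+1%:R^-1 :> R.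
  by have [|k] := H (i.+1%:R^-1) i; [rewrite invr_gt0|exists k].
exists (fun i => Posz (m i)); split.
  left=> M; exists `|M|%N => // i /= Mi.
  have [im _] := mP i; lia.
apply/ptws_cvgP => j.
apply/metricType_numDomainType.cvgrPdist_le => e e0.
have : \forall i \near \oo, i.+1%:R^-1 < e.
  exact: near_infty_natSinv_lt (PosNum e0).
apply: filterS => i ie.
change (mdist (z j) (int_iter (power n (hyper_map T)) (m i) z j) <= e).
rewrite int_iter_power.
have close x : mdist (iter (m i) T x) x < e.
  by have [_ /(_ x)] := mP i; move=> /lt_trans; apply.
apply: hausdorff_dist_lb; split; rewrite ?int_iter_hyper_map //.
  by move=> x zx; exists (iter (m i) T x) => //; exists x.
by move=> _ [x zx <-]; exists x => //; rewrite metric_sym; exact: close.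
Qed.

End hyper_iter.

(** * Translations, rotations and cocycles of skew products *)

Lemma mdist_pairE (R : realType) (M N : metricType R) (x x' : M) (y y' : N) :
  mdist (x, y) (x', y') = Num.max (mdist x x') (mdist y y').
Proof. by []. Qed.

(** Equicontinuity of the right translations; it stands in for an invariant metric on [G]. *)
Lemma mulg_unif_continuous (R : realType) (G : compactMetricGroupType R) (e : R) :
  0 < e -> exists2 d : R, 0 < d &
    forall x y k : G, mdist x y < d -> mdist (x * k)%g (y * k)%g < e.
Proof.
move=> e0; have [d d0 H] := compact_unif_continuous (@mulg_continuous R G) e0.
exists d => // x y k xy; apply: (H (x, k) (y, k)).
by rewrite mdist_pairE mdistxx gt_max xy d0.
Qed.

Lemma int_iter_rotation (R : realType) (G : compactMetricGroupType R) (a : G)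
    (m : int) (g : G) :
  int_iter (rotation a) m g = (int_iter (rotation a) m 1 * g)%g.
Proof.
case: m => k; rewrite /int_iter.
  by elim: k => [|k IHk] /=; rewrite ?mul1g // IHk mulgA.
by elim: k.+1 => [|j IHj] /=; rewrite ?mul1g // IHj mulgA.
Qed.

Section skew.
Context {R : realType} {Y : compactMetricType R} {G : compactMetricGroupType R}.
Variables (S : homeomorphism Y) (phi : Y -> G) (cphi : continuous phi).
Let T := skew_product S cphi.

Definition cocycle (m : int) (y : Y) : G := (int_iter T m (y, 1%g)).2.

(** On fibres both [T] and its inverse act by left multiplication, which commutes with right
    translation by [g]; hence the orbit of [(y, 1)] determines that of [(y, g)]. *)
Lemma int_iter_skew_product m y g :
  int_iter T m (y, g) = (int_iter S m y, (cocycle m y * g)%g).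
Proof.
have iter_skew (s : Y -> Y) (c : Y -> G) (f : Y * G -> Y * G) k :
    (forall z h, f (z, h) = (s z, (c z * h)%g)) ->
    iter k f (y, g) = (iter k s y, ((iter k f (y, 1)).2 * g)%g).
  move=> fE; elim: k g => [|k IHk] h; first by rewrite /= mul1g.
  by rewrite !iterS IHk [in RHS]IHk !fE /= mulg1 mulgA.
rewrite /cocycle; case: m => k.
  exact: (iter_skew (hom_fun S) phi).
exact: (iter_skew (hom_inv S) (fun z => (phi (hom_inv S z))^-1%g)).
Qed.

End skew.

(** * From recurrent slabs to uniform rigidity of the tower *)

Section tower.
Context {R : realType} (G : nat -> compactMetricGroupType R) (a : G 0%N).
Variables (phi : forall i, tower G i -> G i.+1).
Arguments phi : clear implicits.
Hypothesis cphi : forall i, continuous (phi i).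
Arguments cphi : clear implicits.
Let T := tower_map a cphi.
Let c q := cocycle (T q) (cphi q).
Arguments c : clear implicits.

Lemma int_iter_tower q m y (h : G q.+1) :
  int_iter (T q.+1) m (y, h) = (int_iter (T q) m y, (c q m y * h)%g).
Proof. exact: int_iter_skew_product. Qed.

Lemma slab_setT m (g : forall j, G j) p : (p <= m)%N ->
  @slab_set R G m g p = setT.
Proof.
elim: p => [//|p IHp] pm /=.
by rewrite pm IHp ?(ltnW pm) // setXTT.
Qed.

(** Append [g n.+1] to a point of the lower slab, apply the hypothesis and drop the last coordinate;
    this does not increase the maximum distance. *)
Lemma slab_near_project q (g : forall j, G j) (m : int) (d : R) n :
  (q < n)%N ->
  (forall x, @slab_set R G q g n x ->
     thickening (@slab_set R G q g n) d (int_iter (T n) m x)) ->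
  forall x, @slab_set R G q g q.+1 x ->
     thickening (@slab_set R G q g q.+1) d (int_iter (T q.+1) m x).
Proof.
elim: n => [//|n IHn]; rewrite ltnS leq_eqVlt => /predU1P[->//|qn] H.
apply: IHn => // x xq.
have [|[y h] [yq _]] := H (x, g n.+1).
  by split=> //=; rewrite ltnNge (ltnW qn).
rewrite int_iter_tower.
by rewrite mdist_pairE gt_max => /andP[yx _]; exists y.
Qed.

(** At level [q.+1] the slab is the full base times [{g q.+1}], so only the last coordinate of the
    image of [(y, g q.+1)] is constrained. *)
Lemma cocycle_near_slab q (g : forall j, G j) (m : int) (d : R) n :
  (q < n)%N -> mdist (slab q g n) (int_iter (hyper_map (T n)) m (slab q g n)) < d ->
  forall y, mdist (c q m y * g q.+1)%g (g q.+1) < d.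
Proof.
move=> qn /hausdorff_dist_lt[_ _]; rewrite int_iter_hyper_map => H y.
have [||[z h]] := @slab_near_project q g m d n qn _ (y, g q.+1).
- by move=> x xq; apply: H; exists x.
- by rewrite /= ltnn slab_setT.
rewrite /= ltnn => -[_ /= ->].
rewrite int_iter_tower.
by rewrite mdist_pairE gt_max => /andP[_]; rewrite metric_sym.
Qed.

Lemma recurrent_slab_cocycle n (g : forall j : nat, nat -> G j) (u : nat -> int) :
  int_iter (power n (hyper_map (T n))) (u i) (slab_tuple g n) @[i --> \oo]
    --> slab_tuple g n ->
  forall q (e : R), (q < n)%N -> 0 < e ->
    \forall i \near \oo, forall y h, mdist (c q (u i) y * h)%g h < e.
Proof.
move=> /ptws_cvgP u_cvg q e qn e0.
have kn : (n - q.+1 < n)%N by lia.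
have tupleE : slab_tuple g n (Ordinal kn) = slab q (fun j => g j (j - q)%N) n.
  by rewrite /slab_tuple /=; have -> : (n - (n - q.+1).+1 = q)%N by lia.
have [d d0 dP] := mulg_unif_continuous (G q.+1) e0.
set f := (fun j => _) in tupleE.
have u_near : \forall i \near \oo, mdist (slab_tuple g n (Ordinal kn))
    (int_iter (power n (hyper_map (T n))) (u i) (slab_tuple g n) (Ordinal kn)) < d.
  exact: (metricType_numDomainType.cvgrPdist_lt _ _).1
    (u_cvg (Ordinal kn)) d d0.
apply: filterS u_near => i; rewrite int_iter_power tupleE => H y h.
(* Right translation by [(f q.+1)^-1 * h] moves the estimate from [f q.+1] to an arbitrary [h],
   uniformly in [h]. *)
have := dP _ _ ((f q.+1)^-1 * h)%g (cocycle_near_slab qn H y).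
by rewrite -mulgA !mulVKg.
Qed.

(** Induction on the level: [d] comes from the base rotation alone, and each further fibre costs
    [e / 2] for each of the two cocycle values. *)
Lemma tower_iter_close n (u : nat -> int) :
  (forall q (e : R), (q < n)%N -> 0 < e ->
     \forall i \near \oo, forall y h, mdist (c q (u i) y * h)%g h < e) ->
  forall p (e : R), (p <= n)%N -> 0 < e ->
  exists2 d : R, 0 < d & \forall i \near \oo, \forall j \near \oo,
    mdist (int_iter (rotation a) (u i) 1%g) (int_iter (rotation a) (u j) 1%g) < d ->
    forall x, mdist (int_iter (T p) (u i) x) (int_iter (T p) (u j) x) < e.
Proof.
move=> c_id; elim=> [|p IHp] e pn e0.
  have [d d0 dP] := mulg_unif_continuous (G 0%N) e0.
  exists d => //; apply: nearW => i; apply: nearW => j ij x.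
  rewrite (int_iter_rotation a (u i)) (int_iter_rotation a (u j)).
  exact: dP.
have [d d0 dP] := IHp _ (ltnW pn) e0; exists d => //.
have cp : \forall i \near \oo, forall y h, mdist (c p (u i) y * h)%g h < e / 2.
  by apply: c_id => //; rewrite divr_gt0.
apply: (filterS2 _ _ dP cp) => i iP ci.
apply: (filterS2 _ _ iP cp) => j jP cj ij [y h].
rewrite !int_iter_tower.
rewrite [mdist _ _]mdist_pairE gt_max; apply/andP; split; first exact: jP.
apply: le_lt_trans (metric_triangle _ h _) _.
by rewrite [e]splitr ltrD // metric_sym.
Qed.

Lemma recurrent_slab_uniformly_rigid n (g : forall j : nat, nat -> G j) :
  recurrent (power n (hyper_map (T n))) (slab_tuple g n) ->
  uniformly_rigid (T n).
Proof.
move=> [u [u_oo /recurrent_slab_cocycle/tower_iter_close close]].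
apply/uniformly_rigidP => e N e0.
have {close} [d d0 dP] := close n e (leqnn n) e0.
pose r i := int_iter (rotation a) (u i) 1%g.
(* [r] need not converge; a cluster point [b] is enough to bring [r i] and [r j] within [d] of each
   other for suitable large [i] and [j]. *)
have [b [_ b_cluster]] := @space_compact R (G 0%N) (r @ \oo) _ filterT.
have freq (P : set nat) : (\forall i \near \oo, P i) ->
    exists2 i, P i & mdist b (r i) < d / 2.
  move=> nP; have [||_ [[i Pi <-]]] := b_cluster (r @` P) (ball b (d / 2)).
  - by apply: filterS nP => i Pi; exists i.
  - by apply: nbhsx_ballx; rewrite divr_gt0.
  - by rewrite ballEmdist => bi; exists i.
have [i iP bi] := freq _ dP.
(* With [i] fixed, closeness and a time gap above [N] hold for all large [j]; the cluster point
   supplies such a [j] with [r j] near [b]. *)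
have [j [jP uij] bj] : exists2 j, (mdist (r i) (r j) < d ->
      forall x, mdist (int_iter (T n) (u i) x) (int_iter (T n) (u j) x) < e)
      /\ (u i + N.+1%:Z <= u j \/ u j <= u i - N.+1%:Z) & mdist b (r j) < d / 2.
  apply: freq; case: u_oo => [/(_ (u i + N.+1%:Z))|/(_ (u i - N.+1%:Z))] uN.
    by apply: (filterS2 _ _ iP uN) => j; split=> //; left.
  by apply: (filterS2 _ _ iP uN) => j; split=> //; right.
have {}jP : forall x, mdist (int_iter (T n) (u i) x) (int_iter (T n) (u j) x) < e.
  apply: jP; apply: le_lt_trans (metric_triangle _ b _) _.
  by rewrite [d]splitr ltrD // metric_sym.
exists `|u j - u i|%N; first by lia.
(* Write [x] as the iterate of some [y] at the smaller of the times [u i] and [u j]; the iterate of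
   [y] at the larger time is then the wanted forward iterate of [x]. *)
move=> x; case: uij => uij.
  have [y <-] := int_iter_surj (T n) (u i) x.
  rewrite -int_iterD metric_sym.
  by have -> : u i + `|u j - u i|%N = u j by lia.
have [y <-] := int_iter_surj (T n) (u j) x.
rewrite -int_iterD.
by have -> : u j + `|u j - u i|%N = u i by lia.
Qed.

End tower.

Theorem theorem5p12 (R : realType) (n : nat) (hn : (2 <= n)%N)
    (G : nat -> compactMetricGroupType R)
    (G0_abelian : forall x y : G 0%N, (x * y = y * x)%g)
    (a : G 0%N) (S0_minimal : minimal (rotation a))
    (phi : forall i : nat, tower G i -> G i.+1)
    (phi_continuous : forall i : nat, continuous (phi i)) :
  let T := tower_map a phi_continuous n in
  [<-> recurrent (power n (hyper_map T)) (slab_tuple (fun j _ => 1%g : G j) n);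
       exists g : forall j : nat, nat -> G j,
         recurrent (power n (hyper_map T)) (slab_tuple g n);
       rigid n (hyper_map T);
       uniformly_rigid T].
Proof.
move=> T; tfae.
- by move=> H; exists (fun j _ => 1%g).
(* Both this implication and the last one pass through a statement outside their own two: uniform
   rigidity here, rigidity of the hyperspace there. *)
- move=> [g H]; apply: uniformly_rigid_hyper_map.
  exact: recurrent_slab_uniformly_rigid H.
- move=> H; exact: (recurrent_slab_uniformly_rigid (g := fun j _ => 1%g) (H _)).
- by move=> /uniformly_rigid_hyper_map H; exact: H.
Qed.
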